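(* Let $L$ satisfy assumption (A) of the context, let $\sigma>0$, let $\theta:[0,\infty[\,\to\,]0,1]$, and assume $$C_1\doteq\limsup_{s\to+\infty}\theta(s)\,s<+\infty .$$ For every $x^*\ge\frac1{r+\lambda}$, let $(V(\cdot,x^* ),p(\cdot,x^* ))$ be a solution of the boundary value problem (BVP) of the context, with $V(\cdot,x^* )$ non-decreasing with values in $[0,B]$ and $p(\cdot,x^* )$ non-increasing with values in $[\theta(x^* ),1]$, satisfying the bounds $$V_2(x)\le V(x,x^* )\le V_1(x),\qquad p_1(x)\le p(x,x^* )\le p_2(x)\qquad\text{for all }x\in[0,x^*],$$ where $V_1,V_2,p_1,p_2$ (depending on $x^*$) are defined in the context. Then $$\liminf_{x^*\to\infty}V(x,x^* )\ \ge\ B\Bigl(1-\frac{C_2}{x}\Bigr)\qquad\text{for all }x>M_2\text{ (with }x>0),$$ where $$C_2\doteq C_1+\frac2{r-\mu},\qquad M_2\doteq\frac{\lambda+\mu-r}{\lambda}\,C_1+\frac{2\lambda+\mu-r}{\lambda(r-\mu)}+1 .$$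
   Context: Constants: $r>\mu\ge0$, $\lambda>0$, $\sigma>0$, $B>0$. Assumption (A): $L:[0,1[\,\to\mathbb R$ is twice continuously differentiable, $L(0)=0$, $L'>0$, $L''>0$ on $[0,1[$, $\lim_{u\to1-}L(u)=+\infty$; set $L(1)=+\infty$. Hamiltonian: for $x\ge0$, $\xi\in\mathbb R$, $p\in\,]0,1]$, $$H(x,\xi,p)=\min_{\omega\in[0,1]}\Bigl\{L(\omega)-\frac{\xi}{p}\,\omega\Bigr\}+\Bigl(\frac{\lambda+r}{p}-\lambda+\sigma^2-\mu\Bigr)x\,\xi .$$ (BVP): $V,p$ continuous on $[0,x^*]$, $\mathcal C^2$ on $]0,x^*[$, with $$rV=H(x,V',p)+\frac{(\sigma x)^2}{2}V'',\qquad (r+\lambda)(p-1)=H_\xi(x,V',p)\,p'+\frac{(\sigma x)^2}{2}p''\qquad\text{on }]0,x^*[,$$ $$V(0)=0,\quad V(x^* )=B,\qquad p(0)=1,\quad p(x^* )=\theta(x^* ).$$ Bounding functions for given $x^*\ge\frac{1}{r+\lambda}$: $(\widetilde V_1,p_1)$ is the solution on $]0,x^*]$ of $$r\widetilde V_1=\Bigl(\frac{\lambda+r}{p_1}+\sigma^2\Bigr)x\,\widetilde V_1',\qquad (r+\lambda)(p_1-1)=\Bigl(\frac{\lambda+r}{p_1}+\sigma^2\Bigr)x\,p_1',\qquad \widetilde V_1(x^* )=B,\quad p_1(x^* )=\theta(x^* ),$$ extended continuously to $x=0$ by $\widetilde V_1(0)=0$, $p_1(0)=1$; $V_1(x)=\widetilde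 V_1\bigl(\tfrac1{r+\lambda}\bigr)$ for $x\in[0,\tfrac1{r+\lambda}]$ and $V_1(x)=\widetilde V_1(x)$ for $x\in[\tfrac1{r+\lambda},x^*]$; $$p_2(x)=\min\Bigl\{1,\ \frac1x\Bigl(\theta(x^* )x^*+\frac2{r-\mu}\Bigr)\Bigr\}\ (p_2(0)=1),\qquad V_2(x)=(1-p_2(x))B .$$ *)

(* Defs.v *)
From HB Require Import structures.
From mathcomp Require Import all_boot all_order all_algebra.
From mathcomp Require Import all_classical all_reals all_analysis.

Set Implicit Arguments.
Unset Strict Implicit.
Unset Printing Implicit Defensive.

Import Order.TTheory GRing.Theory Num.Theory.
Import numFieldTopology.Exports numFieldNormedType.Exports.

Local Open Scope ring_scope.
Local Open Scope classical_set_scope.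

(* Difference quotients are taken inside D, hence one-sided derivatives at the
   endpoints of D that belong to D. *)
Definition has_deriv_within {R : realType} (D : set R) (f : R -> R) (x d : R) :
    Prop :=
  (f y - f x) / (y - x) @[y --> within D x^'] --> d.

Definition C2_open {R : realType} (D : set R) (f : R -> R) : Prop :=
  forall x, D x ->
    [/\ derivable f x 1, derivable (derive1 f) x 1 &
        {for x, continuous (derive1 (derive1 f))}].

(* Only the values of L on [0, 1[ matter. The existential
   witnesses are L' and L''. *)
Definition assumptionA {R : realType} (L : R -> R) : Prop :=
  [/\ exists dL ddL : R -> R,
        [/\ forall u : R, 0 <= u < 1 -> has_deriv_within `[0, 1[ L u (dL u),
            forall u : R, 0 <= u < 1 -> has_deriv_within `[0, 1[ dL u (ddL u),
            {within `[0, 1[, continuous ddL},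
            forall u : R, 0 <= u < 1 -> 0 < dL u &
            forall u : R, 0 <= u < 1 -> 0 < ddL u],
      L 0 = 0 &
      L u @[u --> 1^'-] --> +oo].

(* L extended by L(1) = +oo. *)
Definition Lext {R : realType} (L : R -> R) (w : R) : \bar R :=
  if w < 1 then (L w)%:E else +oo%E.

(* The least element of A; the default +oo is used only when there is none. *)
Definition ereal_min {R : realType} (A : set (\bar R)) : \bar R :=
  xget +oo%E [set m | A m /\ forall a, A a -> (m <= a)%E].

(* Under assumptionA the minimum is attained at some w < 1, so fine loses nothing. *)
Definition Ham {R : realType} (r mu lambda sigma : R) (L : R -> R)
    (x xi p : R) : R :=
  fine (ereal_min
    [set (Lext L w - (xi / p * w)%:E)%E | w in `[0, 1]%classic])
  + ((lambda + r) / p - lambda + sigma ^+ 2 - mu) * x * xi.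

Definition Ham_xi {R : realType} (r mu lambda sigma : R) (L : R -> R)
    (x xi p : R) : R :=
  derive1 (fun z : R => Ham r mu lambda sigma L x z p) xi.

Record solves_BVP {R : realType} (r mu lambda sigma B : R) (L theta : R -> R)
    (xs : R) (V p : R -> R) : Prop := SolvesBVP {
  bvp_V_continuous : {within `[0, xs], continuous V};
  bvp_p_continuous : {within `[0, xs], continuous p};
  bvp_V_C2 : C2_open `]0, xs[ V;
  bvp_p_C2 : C2_open `]0, xs[ p;
  bvp_V_eq : forall x : R, 0 < x < xs ->
    r * V x = Ham r mu lambda sigma L x (derive1 V x) (p x)
              + (sigma * x) ^+ 2 / 2 * derive1 (derive1 V) x;
  bvp_p_eq : forall x : R, 0 < x < xs ->
    (r + lambda) * (p x - 1) =
      Ham_xi r mu lambda sigma L x (derive1 V x) (p x) * derive1 p x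
      + (sigma * x) ^+ 2 / 2 * derive1 (derive1 p) x;
  bvp_V0 : V 0 = 0;
  bvp_Vxs : V xs = B;
  bvp_p0 : p 0 = 1;
  bvp_pxs : p xs = theta xs }.

(* The terminal value problem on ]0, xs] whose solution is (Vt1, p1), with its
   continuous extension to 0; p1 != 0 since the equations divide by p1. *)
Record solves_bounding {R : realType} (r lambda sigma B : R) (theta : R -> R)
    (xs : R) (Vt1 p1 : R -> R) : Prop := SolvesBounding {
  bnd_p1_neq0 : forall x : R, 0 < x <= xs -> p1 x != 0;
  bnd_Vt1_eq : forall x : R, 0 < x <= xs -> exists2 d,
    has_deriv_within `]0, xs] Vt1 x d &
    r * Vt1 x = ((lambda + r) / p1 x + sigma ^+ 2) * x * d;
  bnd_p1_eq : forall x : R, 0 < x <= xs -> exists2 d,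
    has_deriv_within `]0, xs] p1 x d &
    (r + lambda) * (p1 x - 1) = ((lambda + r) / p1 x + sigma ^+ 2) * x * d;
  bnd_Vt1_xs : Vt1 xs = B;
  bnd_p1_xs : p1 xs = theta xs;
  bnd_Vt1_0 : Vt1 0 = 0;
  bnd_p1_0 : p1 0 = 1;
  bnd_Vt1_continuous : {within `[0, xs], continuous Vt1};
  bnd_p1_continuous : {within `[0, xs], continuous p1} }.

Definition bound_V1 {R : realType} (r lambda : R) (Vt1 : R -> R) (x : R) : R :=
  if x <= (r + lambda)^-1 then Vt1 (r + lambda)^-1 else Vt1 x.

Definition bound_p2 {R : realType} (r mu : R) (theta : R -> R) (xs x : R) : R :=
  if x == 0 then 1
  else Num.min 1 (x^-1 * (theta xs * xs + 2 / (r - mu))).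

Definition bound_V2 {R : realType} (r mu B : R) (theta : R -> R) (xs x : R) :
    R :=
  (1 - bound_p2 r mu theta xs x) * B.

Definition limsup_theta {R : realType} (theta : R -> R) : \bar R :=
  limf_esup (fun s : R => (theta s * s)%:E) (pinfty_nbhs R).

(* Real-valued C_1: theta > 0 rules out -oo, and < +oo is assumed where it is
   used. *)
Definition C1 {R : realType} (theta : R -> R) : R := fine (limsup_theta theta).

Definition C2 {R : realType} (r mu : R) (theta : R -> R) : R :=
  C1 theta + 2 / (r - mu).

Definition M2 {R : realType} (r mu lambda : R) (theta : R -> R) : R :=
  (lambda + mu - r) / lambda * C1 theta
  + (2 * lambda + mu - r) / (lambda * (r - mu)) + 1.

(* Main.v *)
Require Import Defs.
From HB Require Import structures.
From mathcomp Require Import all_boot all_order all_algebra.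
From mathcomp Require Import all_classical all_reals all_analysis.
Import Order.TTheory GRing.Theory Num.Theory.
Import numFieldTopology.Exports numFieldNormedType.Exports.
Local Open Scope ring_scope.
Local Open Scope classical_set_scope.

(* At a fixed [x > 0], the lower bound [V_2] depends on [xs] only through
   [t = theta xs * xs]: it is the positive part of a nonincreasing affine
   function of [t]. Passing to the liminf in [V_2 <= V] therefore replaces [t]
   by its limsup [C_1]. *)

Section limf_esup_einf_near.
Context {T : choiceType} {X : filteredType T} {R : realType}.
Implicit Types (f g : X -> \bar R) (F : set_system X).
Local Open Scope ereal_scope.

Lemma limf_esup_lt_near f F a : Filter F ->
  limf_esup f F < a -> \forall x \near F, f x < a.
Proof.
move=> FF /ereal_inf_lt[_ [A FA <-]] supA; apply: filterS FA => x Ax.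
by apply: le_lt_trans supA; apply: ereal_sup_ubound; exists x.
Qed.

Lemma near_limf_einf_ge f F a :
  (\forall x \near F, a <= f x) -> a <= limf_einf f F.
Proof.
move=> Fa; rewrite limf_einfE; apply: le_ereal_sup_tmp.
exists (ereal_inf (f @` [set x | a <= f x])).
  by exists [set x | a <= f x].
by apply: le_ereal_inf_tmp => _ [x ? <-].
Qed.

Lemma near_le_limf_einf f g F : Filter F ->
  (\forall x \near F, f x <= g x) -> limf_einf f F <= limf_einf g F.
Proof.
move=> FF fg; rewrite limf_einfE; apply: ge_ereal_sup => _ [A FA <-].
apply: near_limf_einf_ge; apply: filterS2 FA fg => x Ax.
by apply: le_trans; apply: ereal_inf_lbound; exists x.
Qed.

Lemma limf_einf_comp_nonincreasing_ge (phi : R -> R) (u : X -> R) F (l : R) :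
  Filter F -> {homo phi : s t /~ (s <= t)%R} -> phi t @[t --> l^'+] --> phi l ->
  limf_esup (EFin \o u) F <= l%:E ->
  (phi l)%:E <= limf_einf (EFin \o phi \o u) F.
Proof.
move=> FF phi_ni phi_l ul.
have phi_ge t : (l < t)%R -> (phi t)%:E <= limf_einf (EFin \o phi \o u) F.
  move=> lt; apply: near_limf_einf_ge.
  have /limf_esup_lt_near : limf_esup (EFin \o u) F < t%:E.
    by rewrite (le_lt_trans ul)// lte_fin.
  by apply: filterS => x /ltW ut; rewrite lee_fin phi_ni.
apply: (@cvge_le _ l^'+ _ _ (EFin \o phi)).
  by near=> t; apply: phi_ge; near: t; exact: nbhs_right_gt.
by apply: cvg_EFin phi_l; near=> t.
Unshelve. all: by end_near. Qed.

End limf_esup_einf_near.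

Definition V2_branch {R : realType} (r mu B x t : R) : R :=
  B * (1 - (t + 2 / (r - mu)) / x).

Lemma bound_V2E {R : realType} (r mu B : R) (theta : R -> R) (xs x : R) :
  0 <= B -> x != 0 ->
  bound_V2 r mu B theta xs x =
    Num.max 0 (V2_branch r mu B x (theta xs * xs)).
Proof.
move=> B0 x0; rewrite /bound_V2 /bound_p2 (negbTE x0) /V2_branch.
by rewrite oppr_min addr_maxr subrr maxr_pMl// mul0r mulrC (mulrC x^-1).
Qed.

Lemma V2_branch_nonincreasing {R : realType} (r mu B x : R) :
  0 <= B -> 0 <= x -> {homo V2_branch r mu B x : s t /~ s <= t}.
Proof.
move=> B0 x0 s t st.
by rewrite ler_wpM2l// lerD2l lerN2 ler_wpM2r ?invr_ge0// lerD2r.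
Qed.

Lemma V2_branch_continuous {R : realType} (r mu B x : R) :
  continuous (V2_branch r mu B x).
Proof.
move=> t; apply: cvgM; first exact: cvg_cst.
apply: cvgB; first exact: cvg_cst.
by apply: cvgM; [apply: cvgD; [exact: cvg_id|exact: cvg_cst]|exact: cvg_cst].
Qed.

(* When the limsup is [-oo], [fine] gives [C1] the junk value [0], which is
   still an upper bound. *)
Lemma limsup_theta_le_C1 {R : realType} (theta : R -> R) :
  (limsup_theta theta < +oo)%E -> (limsup_theta theta <= (C1 theta)%:E)%E.
Proof. by rewrite /C1; case: limsup_theta => //= *; rewrite leNye. Qed.

Theorem corollary6p3 (R : realType) (r mu lambda sigma B : R)
  (hmu : 0 <= mu) (hr : mu < r) (hlambda : 0 < lambda) (hsigma : 0 < sigma)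
  (hB : 0 < B)
  (L : R -> R) (hL : assumptionA L)
  (theta : R -> R) (htheta : forall s : R, 0 <= s -> 0 < theta s <= 1)
  (hC1 : (limsup_theta theta < +oo)%E)
  (V p Vt1 p1 : R -> R -> R)
  (hBVP : forall xs : R, (r + lambda)^-1 <= xs ->
    solves_BVP r mu lambda sigma B L theta xs (V ^~ xs) (p ^~ xs))
  (hVmono : forall xs : R, (r + lambda)^-1 <= xs ->
    forall x y : R, 0 <= x -> x <= y -> y <= xs -> V x xs <= V y xs)
  (hVrange : forall xs : R, (r + lambda)^-1 <= xs ->
    forall x : R, 0 <= x <= xs -> 0 <= V x xs <= B)
  (hpmono : forall xs : R, (r + lambda)^-1 <= xs ->
    forall x y : R, 0 <= x -> x <= y -> y <= xs -> p y xs <= p x xs)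
  (hprange : forall xs : R, (r + lambda)^-1 <= xs ->
    forall x : R, 0 <= x <= xs -> theta xs <= p x xs <= 1)
  (hbounding : forall xs : R, (r + lambda)^-1 <= xs ->
    solves_bounding r lambda sigma B theta xs (Vt1 ^~ xs) (p1 ^~ xs))
  (hVbounds : forall xs : R, (r + lambda)^-1 <= xs ->
    forall x : R, 0 <= x <= xs ->
      bound_V2 r mu B theta xs x <= V x xs <= bound_V1 r lambda (Vt1 ^~ xs) x)
  (hpbounds : forall xs : R, (r + lambda)^-1 <= xs ->
    forall x : R, 0 <= x <= xs ->
      p1 x xs <= p x xs <= bound_p2 r mu theta xs x) :
  forall x : R, 0 < x -> M2 r mu lambda theta < x ->
    ((B * (1 - C2 r mu theta / x))%:E
      <= limf_einf (fun xs : R => (V x xs)%:E) (pinfty_nbhs R))%E.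
Proof.
move=> x x0 _.
have liminf_V2_ge : ((B * (1 - C2 r mu theta / x))%:E <=
    limf_einf (fun xs : R => (V2_branch r mu B x (theta xs * xs))%:E)
      (pinfty_nbhs R))%E.
  apply: (limf_einf_comp_nonincreasing_ge (V2_branch r mu B x)).
  - by apply: V2_branch_nonincreasing; exact: ltW.
  - by apply: cvg_at_right_filter; exact: V2_branch_continuous.
  - exact: limsup_theta_le_C1.
apply: (le_trans liminf_V2_ge); apply: near_le_limf_einf; near=> xs.
have xs_large : (r + lambda)^-1 <= xs.
  by near: xs; apply: nbhs_pinfty_ge; exact: num_real.
have x_in : 0 <= x <= xs.
  by rewrite ltW//=; near: xs; apply: nbhs_pinfty_ge; exact: num_real.
have /andP[V2_le_V _] := hVbounds xs xs_large x x_in.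
rewrite /= lee_fin (le_trans _ V2_le_V)//.
by rewrite bound_V2E ?(ltW hB) ?gt_eqF// le_max lexx orbT.
Unshelve. all: by end_near. Qed.
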